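(* Let $E,F$ be Euclidean spaces, let $X\subset E$ be a nonempty convex compact set, and let $\Phi:X\to E$ be a monotone operator represented on $X$ by data $F,A,a,y(\cdot),G(\cdot),Y$ (see context). Let $\Psi:Y\to F$ be the dual operator defined by $\Psi(y)=A^*x(y)-G(y)$, where for each $y\in Y$ the point $x(y)\in X$ is a minimizer of $\langle Ay+a,x\rangle$ over $x\in X$. Let $\mathcal{C}^N=\{y_t,\lambda_t,-\Psi(y_t)\}_{t=1}^N$ be an accuracy certificate associated with the operator $-\Psi$ and $Y$, i.e. $y_t\in Y$, $\lambda_t\ge 0$, $\sum_{t=1}^N\lambda_t=1$. Set $x_t=x(y_t)$, $1\le t\le N$, and $$\widehat{x}=\sum_{t=1}^N\lambda_t x_t\in X,\qquad Y(X)=\{y(x):x\in X\}\subset Y.$$ Then $$\epsilon_{\rm vi}(\widehat{x}\,|\,\Phi,X)\le \mathrm{Res}\left(\mathcal{C}^N|Y(X)\right),$$ that is, $$\sup_{x\in X}\langle\Phi(x),\widehat{x}-x\rangle\le\sup_{z\in Y(X)}\sum_{t=1}^N\lambda_t\langle -\Psi(y_t),y_t-z\rangle .$$ If, in addition, $\Phi(x)=c+Sx$ for all $x\in X$, where $c\in E$ and $S:E\to E$ is a skew-symmetric linear operator ($S^*=-S$), then also $$\mathrm{Res}\left(\{x_t,\lambda_t,\Phi(x_t)\}_{t=1}^N|X\right)\le \mathrm{Res}\left(\mathcal{C}^N|Y(X)\right),$$ where the left-hand side is $\sup_{x\in X}\sum_{t=1}^N\lambda_t\langle\Phi(x_t)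,x_t-x\rangle$.
   Context: Euclidean spaces are finite-dimensional real inner product spaces; $B^*$ denotes the adjoint of a linear map $B$. An operator $H:Z\to E'$ on a convex subset $Z$ of a Euclidean space $E'$ is monotone if $\langle H(z)-H(z'),z-z'\rangle\ge0$ for all $z,z'\in Z$. Suprema may take the value $+\infty$. Strong solution: for a closed convex set $Y\subset F$ and an operator $H:Y\to F$, a strong solution of the variational inequality $\mathrm{VI}(H,Y)$ is a point $y_*\in Y$ with $\langle H(y_* ),y-y_*\rangle\ge0$ for all $y\in Y$. Data of a representation: $F$ is a Euclidean space; $y\mapsto Ay+a$ is an affine mapping from $F$ to $E$ ($A:F\to E$ linear, $a\in E$); $Y\subset F$ is a nonempty closed convex set; $G:Y\to F$ is a continuous monotone operator which is good with respect to $A,Y$, meaning that for every $x\in E$ the variational inequality $\mathrm{VI}(G(\cdot)-A^*x,Y)$ has a strong solution; $y(\cdot):E\to Y$ assigns to each $x\in E$ such a strong solution, i.e. $y(x)\in Y$ and $\langle A^*x-G(y(x)),y(x)-y\rangle\ge0$ for all $y\in Y$. The data represent $\Phi$ on $X$ if $\Phi(x)=Ay(x)+a$ for all $x\in X$. Dual gap function: $\epsilon_{\rm vi}(x|\Phi,X)=\sup_{z\in X}\langle\Phi(z),x-z\rangle$. Accuracy certificate and resolution: for an operator $H$ on a set $Z$, an $N$-step accuracy certificate is a collection $\mathcal{C}^N=\{z_t,\lambda_t,H(z_t)\}_{t=1}^N$ with $z_t\in Z$, $\lambda_t\ge0$, $\sum_t\lambda_t=1$; its resolution with respect to $Z'\subset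 Z$ is $\mathrm{Res}(\mathcal{C}^N|Z')=\sup_{z\in Z'}\sum_{t=1}^N\lambda_t\langle H(z_t),z_t-z\rangle$. *)

(* Defs.v *)
From HB Require Import structures.
From mathcomp Require Import all_boot all_order all_algebra.
From mathcomp Require Import lra.
From mathcomp Require Import all_classical all_reals all_analysis.

Set Implicit Arguments.
Unset Strict Implicit.
Unset Printing Implicit Defensive.

Import Order.TTheory GRing.Theory Num.Theory.
Import numFieldNormedType.Exports.
Local Open Scope classical_set_scope.
Local Open Scope ring_scope.

(* The norm, hence the topology, is the one induced by the inner product. *)
HB.mixin Record NormedModule_isEuclidean (R : realType) E
    & NormedModule R E & GRing.Lmodule R E := {
  inner : {dot E for (@idfun R)};
  norm_inner : forall x : E, `|x| = Num.sqrt (inner x x)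
}.

#[short(type="euclideanType")]
HB.structure Definition Euclidean (R : realType) :=
  {E of Vector R E & NormedModule R E & NormedModule_isEuclidean R E}.

Notation "''[' u , v ]" := (inner u v) : ring_scope.

(* Any finite-dimensional real space with an inner product is Euclidean. *)
HB.factory Record Vector_isEuclidean (R : realType) E & Vector R E := {
  form : {dot E for (@idfun R)}
}.

HB.builders Context R E & Vector_isEuclidean R E.

Let nrm (x : E) : R := Num.sqrt (form x x).

Let form_ge0 x : 0 <= form x x.
Proof.
have [->|x0] := eqVneq x 0; first by rewrite linear0l.
exact/ltW/neq0_dnorm_gt0.
Qed.

Let formC x y : form x y = form y x.
Proof. by rewrite hermitian_subproof expr0 mul1r. Qed.

Let nrm_eq0 x : nrm x = 0 -> x = 0.
Proof.
apply: contra_eq => x0.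
by rewrite /nrm gt_eqF// sqrtr_gt0 neq0_dnorm_gt0.
Qed.

Let nrmZ (l : R) x : nrm (l *: x) = `|l| * nrm x.
Proof.
rewrite /nrm linearZl_LR linearZr_LR /= mulrA -expr2 sqrtrM ?sqr_ge0//.
by rewrite sqrtr_sqr.
Qed.

Let nrm_le x y : nrm (x + y) <= nrm x + nrm y.
Proof.
have sqn z : nrm z ^+ 2 = form z z by rewrite sqr_sqrtr.
have n0 z : 0 <= nrm z := sqrtr_ge0 _.
have CS : form x y <= nrm x * nrm y.
  have [->|y0] := eqVneq y 0; first by rewrite linear0r mulr_ge0.
  have [->|x0] := eqVneq x 0; first by rewrite linear0l mulr_ge0.
  have ny : 0 < nrm y by rewrite sqrtr_gt0 neq0_dnorm_gt0.
  have nx : 0 < nrm x by rewrite sqrtr_gt0 neq0_dnorm_gt0.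
  have := form_ge0 (nrm y *: x - nrm x *: y).
  rewrite !(linearBl, linearBr) /= !(linearZl_LR, linearZr_LR) /= -!sqn.
  rewrite (formC y x).
  move: (form x y) (nrm x) (nrm y) nx ny => f a b a0 b0.
  rewrite -[leRHS]/(b * (b * a ^+ 2) - a * (b * f)
                    - (b * (a * f) - a * (a * b ^+ 2))) => H.
  have {}H : 0 <= 2 * (a * b) * (a * b - f) by apply: le_trans H _; lra.
  by move: H; rewrite pmulr_rge0 ?mulr_gt0// subr_ge0.
rewrite -(@ler_pXn2r _ 2) ?nnegrE ?addr_ge0// sqrrD !sqn.
rewrite linearDl !linearDr /= (formC y x) => *.
by move: CS; lra.
Qed.

HB.instance Definition _ := Lmodule_isNormed.Build R E nrm_le nrmZ nrm_eq0.
HB.instance Definition _ :=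
  NormedModule_isEuclidean.Build R E (fun=> erefl).

HB.end.

Section Adjoint.
Context {R : realType} {E F : euclideanType R}.

Definition adjoint (A : 'Hom(E, F)) : 'Hom(F, E) :=
  xget 0 [set B : 'Hom(F, E) | forall x y, '[A x, y] = '[x, B y]].

Lemma adjointP (A : 'Hom(E, F)) x y : '[A x, y] = '[x, adjoint A y].
Proof.
suff [B AB] : exists B : 'Hom(F, E), forall x y, '[A x, y] = '[x, B y].
  rewrite /adjoint; case: xgetP => [C _ /(_ x y)//|/(_ B)[]]; exact: AB.
set e := vbasis {:E}.
pose n := \dim {:E}.
have e_eq0 u v : (forall i : 'I_n, '[e`_i, u] = '[e`_i, v]) -> u = v.
  move=> euv; apply/eqP; rewrite -subr_eq0; apply: contraT => uv0.
  have := @neq0_dnorm_gt0 _ _ _ (inner : {dot E for _}) _ uv0.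
  rewrite {1}(coord_vbasis (memvf (u - v))) linear_sumlz big1 ?ltxx// => i _.
  have := euv i; rewrite -/e linearZl_LR /= linearBr /= => ->.
  by rewrite subrr mulr0.
pose l u : 'rV[R]_n := \row_i '[e`_i, u].
have l_lin : linear l.
  by move=> k u v; apply/rowP => i; rewrite !mxE linearDr linearZr_LR.
pose r y : 'rV[R]_n := \row_i '[A e`_i, y].
have r_lin : linear r.
  by move=> k u v; apply/rowP => i; rewrite !mxE linearDr linearZr_LR.
pose lL := GRing.isLinear.Build _ _ _ _ l l_lin.
pose rL := GRing.isLinear.Build _ _ _ _ r r_lin.
pose L : 'Hom(E, 'rV[R]_n) := linfun (HB.pack l lL : {linear E -> 'rV[R]_n}).
pose Q : 'Hom(F, 'rV[R]_n) := linfun (HB.pack r rL : {linear F -> 'rV[R]_n}).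
have kL : lker L == 0%VS.
  apply/lker0P => u v; rewrite !lfunE /= => /rowP luv.
  by apply: e_eq0 => i; have := luv i; rewrite !mxE.
have fL : limg L = fullv.
  apply/eqP; rewrite eqEdim subvf /= limg_dim_eq; last first.
    by rewrite (eqP kL) capv0.
  by rewrite -/n (dimvf 'rV[R]_n) /dim /= mul1n.
exists (L^-1 \o Q)%VF => u v; rewrite comp_lfunE.
have LQ : L (L^-1 (Q v))%VF = Q v by rewrite limg_lfunVK// fL memvf.
rewrite (coord_vbasis (memvf u)) linear_sum !linear_sumlz.
apply: eq_bigr => i _; rewrite linearZ !linearZl_LR /=; congr (_ * _).
by move/rowP/(_ i): LQ; rewrite !lfunE /= !mxE.
Qed.

End Adjoint.

Section VariationalInequalities.
Context {R : realType} {E : euclideanType R}.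
Implicit Types (H : E -> E) (Z : set E).

Definition monotone_operator H Z :=
  forall z z', Z z -> Z z' -> 0 <= '[H z - H z', z - z'].

Definition strong_solution H Z (z : E) :=
  Z z /\ forall z', Z z' -> 0 <= '[H z, z' - z].

Definition dual_gap H Z (x : E) : \bar R :=
  ereal_sup [set '[H z, x - z]%:E | z in Z].

(* The certificate {(z_t, lambda_t, H(z_t)) : t} is given by the families z and
   lambda, indexed from 0; the condition on the sum forces 0 < N. *)
Definition certificate Z N (z : 'I_N -> E) (lambda : 'I_N -> R) :=
  [/\ forall t, Z (z t), forall t, 0 <= lambda t & \sum_t lambda t = 1].

Definition resolution H N (z : 'I_N -> E) (lambda : 'I_N -> R) Z : \bar R :=
  ereal_sup [set (\sum_t lambda t * '[H (z t), z t - z'])%:E | z' in Z].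

End VariationalInequalities.

Section Representation.
Context {R : realType} {E F : euclideanType R}.
Implicit Types (A : 'Hom(F, E)) (a : E) (G : F -> F) (X : set E) (Y : set F).

Definition good A Y G :=
  forall x, exists y, strong_solution (fun y' => G y' - adjoint A x) Y y.

(* Operators defined on a subset are total functions, of which only the values
   on the subset are constrained. *)
Definition representation_data A a (ysol : E -> F) G Y :=
  [/\ [/\ Y !=set0, closed Y & convex_set Y],
      {within Y, continuous G}, monotone_operator G Y, good A Y G
    & forall x, strong_solution (fun y' => G y' - adjoint A x) Y (ysol x)].

Definition represents A a ysol G Y (Phi : E -> E) X :=
  representation_data A a ysol G Y /\
  forall x, X x -> Phi x = A (ysol x) + a.

Definition linear_minimizer A a X Y (xmin : F -> E) :=
  forall y, Y y ->
    X (xmin y) /\ forall x, X x -> '[A y + a, xmin y] <= '[A y + a, x].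

Definition dual_operator A G (xmin : F -> E) (y : F) : F :=
  adjoint A (xmin y) - G y.

End Representation.

(* Main.v *)
Require Import Defs.
From HB Require Import structures.
From mathcomp Require Import all_boot all_order all_algebra.
From mathcomp Require Import lra.
From mathcomp Require Import all_classical all_reals all_analysis.

Set Implicit Arguments.
Unset Strict Implicit.
Unset Printing Implicit Defensive.

Import Order.TTheory GRing.Theory Num.Theory.
Import numFieldNormedType.Exports.
Local Open Scope classical_set_scope.
Local Open Scope ring_scope.

(* The bounds hold summand by summand.  For [x] in [X] and [v = y(x)], so that
   [Phi x = A v + a], the difference between
   [<G y_t - A^* x_t, y_t - v>] and [<Phi x, x_t - x>] is
     (<A y_t + a, x> - <A y_t + a, x_t>) + <G y_t - G v, y_t - v>
       + <G v - A^* x, y_t - v>,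
   whose summands are nonnegative because [x_t] is a minimizer, [G] is
   monotone, and [v] solves [VI(G - A^* x, Y)].  In the skew case
   [<Phi x_t, x_t - x> = <Phi x, x_t - x>]. *)

(** Induction on [n]: the first point is split off and the other weights are divided by their total
    [s], so that binary convexity and the induction hypothesis apply. *)
Lemma convex_set_sum (R : realFieldType) (M : lmodType R) (X : set M) n
    (lambda : 'I_n -> R) (x : 'I_n -> M) :
  convex_set X -> (forall i, 0 <= lambda i) -> \sum_i lambda i = 1 ->
  (forall i, X (x i)) -> X (\sum_i lambda i *: x i).
Proof.
move=> Xconv.
elim: n lambda x => [|n IHn] lambda x lambda_ge0 sum_lambda Xx.
  by move: sum_lambda; rewrite big_ord0 => /eqP; rewrite eq_sym oner_eq0.
move: sum_lambda; rewrite !big_ord_recl.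
set l := lambda ord0; set s := \sum_(i < n) _ => ls.
have s_ge0 : 0 <= s by apply: sumr_ge0 => i _; exact: lambda_ge0.
have l_ge0 : 0 <= l by exact: lambda_ge0.
(* Rescaling needs [s] nonzero; if [s = 0], nonnegativity makes every tail weight vanish, and the
   sum is the first point. *)
have [s0|s_neq0] := eqVneq s 0.
  have tail0 i : lambda (lift ord0 i) = 0.
    by apply/eqP; move/eqP: s0; rewrite psumr_eq0// => /allP; apply;
       rewrite mem_index_enum.
  rewrite big1 => [|i _]; last by rewrite tail0 scale0r.
  by move: ls; rewrite s0 addr0 => ->; rewrite scale1r addr0.
pose z := \sum_(i < n) (lambda (lift ord0 i) / s) *: x (lift ord0 i).
have Xz : X z.
  apply: IHn => // [i|]; first by rewrite divr_ge0.
  by rewrite -mulr_suml divff.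
have -> : \sum_(i < n) lambda (lift ord0 i) *: x (lift ord0 i) = s *: z.
  by rewrite scaler_sumr; apply: eq_bigr => i _; rewrite scalerA mulrC divfK.
(* [convex_set] gives the second point the weight [1 - l], so [s] is put in that form. *)
have -> : s = 1 - l by rewrite -ls addrC addKr.
have l_le1 : l <= 1 by rewrite -ls lerDl.
rewrite -inE.
exact: (Xconv (x ord0) z (Itv01 l_ge0 l_le1) (mem_set (Xx _)) (mem_set Xz)).
Qed.

Lemma innerC (R : realType) (E : euclideanType R) (u v : E) : '[u, v] = '[v, u].
Proof. by rewrite hermC expr0 mul1r. Qed.

(** Skewness gives ['[S u, u] = '[S v, v] = 0] and [- '[S u, v] = '[S v, u]]; the terms in [c]
    agree. *)
Lemma skew_affine_inner (R : realType) (E : euclideanType R) (S : 'Hom(E, E))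
    (c u v : E) :
  adjoint S = - S -> '[c + S u, u - v] = '[c + S v, u - v].
Proof.
move=> skewS; have SN w z : '[S w, z] = - '[S z, w].
  by rewrite adjointP skewS opp_lfunE linearNr innerC.
rewrite !linearDl !linearBr /=.
have := SN u u; have := SN v v; have := SN u v; lra.
Qed.

Lemma representation_inner_le (R : realType) (E F : euclideanType R)
    (X : set E) (Phi : E -> E) (A : 'Hom(F, E)) (a : E) (ysol : E -> F)
    (G : F -> F) (Y : set F) (xmin : F -> E) (x : E) (w : F) :
  represents A a ysol G Y Phi X -> linear_minimizer A a X Y xmin ->
  X x -> Y w ->
  '[Phi x, xmin w - x] <= '[- dual_operator A G xmin w, w - ysol x].
Proof.
move=> [[_ _ G_mono _ ysolP] PhiE] xminP Xx Yw.
have [Yv /(_ _ Yw) v_sol] := ysolP x.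
have mono := G_mono _ _ Yw Yv.
have [_ /(_ _ Xx) min] := xminP _ Yw.
have adjE p q : '[adjoint A p, q] = '[A q, p] by rewrite innerC adjointP.
(* Once [adjE] removes the adjoints, everything is linear in the same inner products, and the goal
   is the sum of the three inequalities. *)
move: v_sol mono min; rewrite PhiE// /dual_operator opprB.
rewrite !(linearDl, linearBl, linearNl, linearDr, linearBr, linearNr) /= !adjE.
lra.
Qed.

Theorem theorem1 (R : realType) (E F : euclideanType R)
  (X : set E) (X_neq0 : X !=set0) (X_convex : convex_set X)
  (X_compact : compact X)
  (Phi : E -> E) (Phi_monotone : monotone_operator Phi X)
  (A : 'Hom(F, E)) (a : E) (ysol : E -> F) (G : F -> F) (Y : set F)
  (Phi_repr : represents A a ysol G Y Phi X)
  (xmin : F -> E) (xminP : linear_minimizer A a X Y xmin)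
  (N : nat) (y : 'I_N -> F) (lambda : 'I_N -> R)
  (cert : certificate Y y lambda) :
  let negPsi : F -> F := fun v => - dual_operator A G xmin v in
  let x : 'I_N -> E := fun t => xmin (y t) in
  let xhat : E := \sum_t lambda t *: x t in
  let YX : set F := [set ysol u | u in X] in
  [/\ X xhat,
      YX `<=` Y,
      (dual_gap Phi X xhat <= resolution negPsi y lambda YX)%E
    & forall (c : E) (S : 'Hom(E, E)), adjoint S = - S ->
        (forall u, X u -> Phi u = c + S u) ->
        (resolution Phi x lambda X <= resolution negPsi y lambda YX)%E].
Proof.
move=> negPsi x xhat YX.
have [Yy lambda_ge0 sum_lambda] := cert.
have Xx t : X (x t) by have [] := xminP _ (Yy t).
(* Both bounds reduce to this one: each [u] in [X] is matched with the point [ysol u] of [YX]. *)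
have le_res u : X u ->
    ((\sum_t lambda t * '[Phi u, x t - u])%:E <= resolution negPsi y lambda YX)%E.
  move=> Xu; apply: le_trans (ereal_sup_ubound _); last first.
    by exists (ysol u) => //; exists u.
  rewrite lee_fin; apply: ler_sum => t _; apply: ler_wpM2l => //.
  exact: representation_inner_le Phi_repr xminP Xu (Yy t).
split.
- exact: convex_set_sum.
- by move=> _ [u _ <-]; have [[_ _ _ _ /(_ u)[]]] := Phi_repr.
- apply: ge_ereal_sup => _ [u Xu <-].
  (* This holds because the weights sum to 1. *)
  suff -> : xhat - u = \sum_t lambda t *: (x t - u).
    rewrite linear_sumr; under eq_bigr do rewrite linearZr_LR /=.
    exact: le_res.
  under eq_bigr do rewrite scalerBr.
  by rewrite sumrB -scaler_suml sum_lambda scale1r.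
- move=> c S skewS PhiE; apply: ge_ereal_sup => _ [u Xu <-].
  (* Skewness replaces [Phi (x t)] by [Phi u] in each summand. *)
  under eq_bigr do rewrite PhiE// (skew_affine_inner _ _ _ skewS) -PhiE//.
  exact: le_res.
Qed.
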